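(* Let $p$ be an odd prime and $q=p^n\equiv 1\pmod 4$. Let $\mathbb{F}_q$ be a finite field of order $q$, let $G=(\mathbb{F}_q,+)$, and let $C_0,C_1,C_2,C_3$ be the cyclotomic classes of order $4$ of $\mathbb{F}_q$. (1) When $P=G-C_l-0_G$ and $N=C_l$ with $l\in\{0,1,2,3\}$, $D=P-N$ is not a signed difference set. (2) When $P=C_i+C_j$ and $N=C_k+C_l$ with $\{i,j,k,l\}=\{0,1,2,3\}$, $D=P-N$ is a $(q,q-1,-1)$-signed difference set if and only if either $i-j\equiv 2\pmod 4$, or $i-j\equiv 1,3\pmod 4$ and $p\equiv -1\pmod 4$.
   Context: Write $q=4f+1$ and fix a primitive element $w$ of $\mathbb{F}_q$. The cyclotomic classes of order $4$ are $C_0=\{w^{4j}:0\le j\le f-1\}$ and $C_i=w^iC_0$ for $0\le i\le 3$. For $G=(\mathbb{F}_q,+)$ with identity $0_G$, a subset $S\subseteq G$ is identified with $\sum_{s\in S}s$ in the group ring $\mathbb{Z}[G]$; thus $C_i+C_j$ and $G-C_l-0_G$ are group ring elements, here representing the disjoint union $C_i\cup C_j$ and the set difference $G\setminus(C_l\cup\{0\})$. For disjoint subsets $P,N$ of $G$, the element $D=P-N$ is a signed set of size $k=|P|+|N|$. For $A=\sum_g a_g g\in\mathbb{Z}[G]$, $A^{-1}=\sum_g a_g g^{-1}$ with $g^{-1}$ the inverse of $g$ in $G$ (i.e. the field element $-g$). $D$ is a $(q,k,\lambda)$-signed difference set if $DD^{-1}=\lambda G+(k-\lambda)\cdot 0_G$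 in $\mathbb{Z}[G]$, where $\lambda$ is an integer; it is a signed difference set if this holds for some $\lambda$. *)

(* Defs.v *)
From mathcomp Require Import all_boot all_order all_algebra all_field.

Set Implicit Arguments.
Unset Strict Implicit.
Unset Printing Implicit Defensive.

Import GRing.Theory.
Local Open Scope ring_scope.

(* An element of the group ring Z[G] of a finite additively written abelian
   group G is the function {ffun G -> int} giving its coefficients. Addition
   is the pointwise one of {ffun G -> int}; the product is convolution. *)
Definition gr_mul (G : finZmodType) (A B : {ffun G -> int}) : {ffun G -> int} :=
  [ffun g => \sum_(h : G) A h * B (g - h)].

Definition gr_inv (G : finZmodType) (A : {ffun G -> int}) : {ffun G -> int} :=
  [ffun g => A (- g)].

Definition gr_set (G : finZmodType) (S : {set G}) : {ffun G -> int} :=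
  [ffun g => (g \in S)%:R].

Record signed_set (G : finZmodType) := SignedSet {
  pos_part : {set G};
  neg_part : {set G};
  parts_disjoint : [disjoint pos_part & neg_part]
}.

Definition signed_elt (G : finZmodType) (D : signed_set G) : {ffun G -> int} :=
  gr_set (pos_part D) - gr_set (neg_part D).

Definition signed_size (G : finZmodType) (D : signed_set G) : nat :=
  (#|pos_part D| + #|neg_part D|)%N.

Definition is_sds (G : finZmodType) (v k : nat) (lambda : int)
    (D : signed_set G) : Prop :=
  [/\ v = #|G|, k = signed_size D
    & gr_mul (signed_elt D) (gr_inv (signed_elt D))
      = gr_set [set: G] *~ lambda + gr_set [set 0] *~ (k%:Z - lambda)].

Definition signed_difference_set (G : finZmodType) (D : signed_set G) : Prop :=
  exists lambda : int, is_sds #|G| (signed_size D) lambda D.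

(* With #|F| = 4 f + 1, the bound below is f. *)
Definition cyc_class0 (F : finFieldType) (w : F) : {set F} :=
  [set w ^+ (4 * j) | j : 'I_(#|F|.-1 %/ 4)].

Definition cyc_class (F : finFieldType) (w : F) (i : nat) : {set F} :=
  [set w ^+ i * x | x in cyc_class0 w].

(* The pairs of sets considered in the theorem are indeed disjoint, so that
   they do define signed sets. *)
Lemma cyc_class_disjoint (F : finFieldType) (w : F) (i j : 'I_4) :
  (#|F|.-1).-primitive_root w -> (4 %| #|F|.-1)%N -> i != j ->
  [disjoint cyc_class w i & cyc_class w j].
Proof.
move=> pw d4 nij; apply/pred0P => x /=; apply/negP => /andP[].
case/imsetP => _ /imsetP[a _ ->] ->; case/imsetP => _ /imsetP[b _ ->].
rewrite -!exprD => /eqP; rewrite (eq_prim_root_expr pw) => /eqP e.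
case/negP: nij; apply/eqP/val_inj => /=.
move: (congr1 (modn^~ 4) e); rewrite /= !modn_dvdm //.
by rewrite ![(_ + 4 * _)%N]addnC ![(4 * _)%N]mulnC !modnMDl !modn_small.
Qed.

Lemma cyc_unions_disjoint (F : finFieldType) (w : F) (i j k l : 'I_4) :
  (#|F|.-1).-primitive_root w -> (4 %| #|F|.-1)%N ->
  [set i; j; k; l] = [set: 'I_4] ->
  [disjoint cyc_class w i :|: cyc_class w j
          & cyc_class w k :|: cyc_class w l].
Proof.
move=> pw d4 e.
have sub : {subset enum 'I_4 <= [:: i; j; k; l]}.
  move=> x _; have: x \in [set i; j; k; l] by rewrite e inE.
  by rewrite !inE -!orbA.
have : uniq [:: i; j; k; l].
  by apply: (leq_size_uniq (enum_uniq 'I_4) sub); rewrite size_enum_ord.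
rewrite /= !inE !negb_or => /and4P[/and3P[_ ik il] /andP[jk jl] _ _].
have dis a b := @cyc_class_disjoint F w a b pw d4.
rewrite -setI_eq0 setIUl !setIUr !setU_eq0 !setI_eq0.
by rewrite (dis i k) ?(dis i l) ?(dis j k) ?(dis j l).
Qed.

Lemma cyc_compl_disjoint (F : finFieldType) (w : F) (l : nat) :
  [disjoint [set: F] :\: (cyc_class w l :|: [set 0]) & cyc_class w l].
Proof.
by rewrite disjoint_sym disjoints_subset setTD setCK subsetUl.
Qed.

(* Main.v *)
(** For d the coefficient function of D, the signed set D is a signed difference
    set when N(g) = sum_h d(h) d(h - g) is constant on g <> 0.

    Write q = 4f + 1 and I = w^f, a square root of -1 in F. The value of d at x
    is a polynomial in x^f over F, and a polynomial of degree < 2(q - 1) sums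
    over F to minus its coefficient of degree q - 1, so N can be computed in F.

    (1) If f is odd, -1 lies in C_2 and N(g) + d(g) + d(-g) is constant modulo 4
    on g <> 0, which fails for g in C_l and C_(l+1). If f is even, the sum over
    g of g^f N(g) would vanish if N were constant, but it equals - c^3 / 2 in F
    for some c <> 0.

    (2) The sum of all N(g) is (sum d)^2 = 0 and N(0) = q - 1, so N is constant
    off 0 iff it is -1 there. If i - j = 2 then d(wx) = - d(x), so
    N(wg) = N(g). If i - j is odd then d(w^2 x) = - d(x), and N is constant iff
    N(1) = N(w). When p = 3 mod 4, the Frobenius automorphism induces on d an
    odd multiplicative shift, whence N(1) = N(w). When p = 1 mod 4, N(1) + 1 is
    a nonzero multiple in F of the binomial coefficient (3f choose f), which is
    prime to p because adding f and 2f in base p produces no carry. *)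
Require Import Defs.
From mathcomp Require Import all_boot all_order all_algebra all_field.
From mathcomp Require Import zify ring.

Set Implicit Arguments.
Unset Strict Implicit.
Unset Printing Implicit Defensive.

Import GRing.Theory.
Local Open Scope ring_scope.

(** * A binomial coefficient modulo p *)

(** Legendre's formula gives v_p((c f)!) = c v_p(f!) for c = 1, 2, 3, so the valuation of (3f)! /
    (f! (2f)!) is (3 - 1 - 2) v_p(f!) = 0. *)
Lemma ndvdn_bin_3f_f (p n f : nat) :
  prime p -> (p %% 4 = 1)%N -> (p ^ n = 4 * f + 1)%N ->
  ~~ (p %| 'C(3 * f, f))%N.
Proof.
move=> pp p4 qf.
have p1 := prime_gt1 pp.
have p40 k : (p ^ k %% 4 = 1)%N.
  by rewrite -modnXm p4 exp1n.
have logn_small (c : nat) : (0 < c <= 3)%N ->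
    logn p ((c * f)`!) = (c * logn p (f`!))%N.
  move=> /andP[c0 c3]; rewrite !logn_fact //.
  (* Terms with k > m vanish, which brings the sums for [f] and [c * f] to a common range. *)
  have ext m N : (m <= N)%N ->
      (\sum_(1 <= k < m.+1) m %/ p ^ k = \sum_(1 <= k < N.+1) m %/ p ^ k)%N.
    move=> mN; rewrite [RHS](@big_cat_nat _ _ _ m.+1) //=.
    rewrite [X in (_ + X)%N]big_nat [X in (_ + X)%N]big1 ?addn0 // => k.
    by case/andP=> mk _; rewrite divn_small // (leq_trans mk) // ltnW //
                           ltn_expl.
  rewrite (ext f (c * f)%N) ?leq_pmull // big_distrr /=.
  apply: eq_big_nat => k /andP[k0 _].
  (* f %/ p ^ k = (p ^ (n - k) - 1) / 4 and the remainder (p ^ k - 1) / 4 is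
     less than p ^ k / 3, so multiplying by c creates no carry. *)
  case: (leqP k n) => kn; last first.
    have qk : (4 * f + 1 < p ^ k)%N by rewrite -qf ltn_exp2l.
    by rewrite !divn_small ?muln0 //; nia.
  have pk0 : (0 < p ^ k)%N by rewrite expn_gt0 (ltnW p1).
  have pk1 : (p ^ k %/ 4 * 4 + 1 = p ^ k)%N by rewrite [RHS](divn_eq _ 4) p40.
  have pm1 : (p ^ (n - k) %/ 4 * 4 + 1 = p ^ (n - k))%N.
    by rewrite [RHS](divn_eq _ 4) p40.
  set a := (p ^ k %/ 4)%N in pk1; set b := (p ^ (n - k) %/ 4)%N in pm1.
  have fE : (f = b * p ^ k + a)%N.
    have : (p ^ n = p ^ (n - k) * p ^ k)%N by rewrite -expnD subnK.
    by rewrite qf -pm1; nia.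
  have small (e : nat) : (e <= 3)%N -> ((e * f) %/ p ^ k = e * b)%N.
    move=> e3; rewrite fE mulnDr mulnA divnMDl // divn_small ?addn0 //; nia.
  by rewrite small // -[X in (c * (X %/ _))%N](mul1n f) small // mul1n.
have le : (f <= 3 * f)%N by rewrite leq_pmull.
have /(congr1 (logn p)) := bin_fact le.
have -> : (3 * f - f = 2 * f)%N by lia.
rewrite !lognM ?muln_gt0 ?bin_gt0 ?fact_gt0 // !logn_small // => E.
have /eqP : logn p 'C(3 * f, f) = 0%N by lia.
by rewrite lognE pp bin_gt0 le /=; case: ifP.
Qed.

(** * Power sums and cyclotomic classes in a field of order 4f + 1 *)

Section FiniteField.
Context {F : finFieldType} {w : F} {f : nat}.
Hypothesis w_prim : (#|F|.-1).-primitive_root w.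
Hypothesis cardF : #|F|.-1 = (4 * f)%N.

Lemma f_gt0 : (0 < f)%N.
Proof. by have := prim_order_gt0 w_prim; rewrite cardF; lia. Qed.
Local Notation f0 := f_gt0.

Lemma cardFS : #|F| = (4 * f).+1.
Proof. by rewrite -cardF prednK // (cardD1 0). Qed.

Lemma prim_neq0 : w != 0.
Proof.
apply/eqP => w0; have := prim_expr_order w_prim.
rewrite w0 expr0n cardF muln_eq0 (gtn_eqF f0) //=.
by move/esym/eqP; rewrite oner_eq0.
Qed.
Local Notation w0 := prim_neq0.

Lemma expf_order (x : F) : x != 0 -> x ^+ (4 * f) = 1.
Proof.
move=> x0; apply: (mulfI x0).
by rewrite -exprS -cardFS expf_card mulr1.
Qed.

Lemma natr4f : (4 * f)%:R = -1 :> F.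
Proof.
have : #|F|%:R = 0 :> F.
  (* Translation by 1 permutes F, so adding [#|F|%:R] to the sum of all elements does not change
     it. *)
  apply: (addrI (\sum_(x : F) x)).
  rewrite addr0 [RHS](reindex_inj (addIr 1)) big_split /=.
  by rewrite sumr_const.
by rewrite cardFS -natr1 => /eqP; rewrite addr_eq0 => /eqP.
Qed.

(** Substituting [w * x] for [x] multiplies the sum by w^m, so it vanishes unless 4f divides m,
    which leaves m = 0 and m = 4f. For m = 0 the convention 0^0 = 1 makes the sum equal to q = 0 in
    F. *)
Lemma sum_expr (m : nat) : (m < 8 * f)%N ->
  \sum_(x : F) x ^+ m = - (m == 4 * f)%:R.
Proof.
move=> mf; case: (posnP m) => [-> | m0].
  under eq_bigr do rewrite expr0.
  rewrite sumr_const eq_sym muln_eq0 (gtn_eqF f0) //= oppr0.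
  by rewrite cardFS -natr1 natr4f addNr.
have fixed : \sum_(x : F) x ^+ m = w ^+ m * \sum_(x : F) x ^+ m.
  rewrite [LHS](reindex_inj (mulfI w0)) big_distrr /=.
  by apply: eq_bigr => x _; rewrite exprMn.
have [m4 | m4] := eqVneq m (4 * f)%N.
  rewrite m4 (bigD1 0) //= expr0n muln_eq0 (gtn_eqF f0) //= add0r.
  under eq_bigr => x x0 do rewrite (expf_order x0).
  by rewrite sumr_const cardC1 cardF natr4f.
rewrite oppr0; apply: contraTeq isT => S0.
have /eqP : (1 - w ^+ m) * \sum_(x : F) x ^+ m = 0.
  by rewrite mulrBl mul1r -fixed subrr.
rewrite mulf_eq0 (negPf S0) orbF subr_eq0 eq_sym -(prim_order_dvd w_prim) cardF.
case/dvdnP => c mE; move: mf m0 m4; rewrite mE => mf m0 /eqP m4.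
have : (c < 2)%N by nia.
by case: c mE mf m0 m4 => [|[|c]] //; lia.
Qed.

Lemma coef_sum_expr (a b : nat) (g : F) : (a + b < 8 * f)%N ->
  \sum_(x : F) x ^+ a * (x - g) ^+ b = - ('X^a * ('X - g%:P) ^+ b)`_(4 * f).
Proof.
move=> ab; set P := 'X^a * _.
have sP : (size P <= (a + b).+1)%N.
  rewrite (leq_trans (size_polyMleq _ _)) // size_polyXn.
  by rewrite size_exp_XsubC addSn addnS.
transitivity (\sum_(x : F) P.[x]).
  by apply: eq_bigr => x _; rewrite !hornerE /=.
under eq_bigr do rewrite horner_coef.
rewrite exchange_big /=.
under eq_bigr => i _.
  rewrite -big_distrr /= sum_expr; last first.
    exact: leq_trans (leq_trans (ltn_ord i) sP) ab.
  over.
case: (ltnP (4 * f) (size P)) => fP; last first.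
  rewrite nth_default // oppr0 big1 // => i _.
  by rewrite (ltn_eqF (leq_trans (ltn_ord i) fP)) oppr0 mulr0.
rewrite (bigD1 (Ordinal fP)) //= eqxx mulrN1 big1 ?addr0 // => i.
by rewrite -val_eqE /= => /negPf ->; rewrite oppr0 mulr0.
Qed.

Lemma sum_shift_small (a b : nat) (g : F) : (a + b < 4 * f)%N ->
  \sum_(x : F) x ^+ a * (x - g) ^+ b = 0.
Proof.
move=> ab; rewrite coef_sum_expr ?nth_default ?oppr0 //; last by lia.
rewrite (leq_trans (size_polyMleq _ _)) // size_polyXn.
by rewrite size_exp_XsubC addSn addnS.
Qed.

Lemma sum_shift_eq (a b : nat) (g : F) : (a + b = 4 * f)%N ->
  \sum_(x : F) x ^+ a * (x - g) ^+ b = -1.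
Proof.
move=> ab; have f_gt0 := f0; rewrite coef_sum_expr ?ab; last by lia.
rewrite coefXnM -ab ltnNge leq_addr /= addKn.
have /monicP := monic_exp b (monicXsubC g).
by rewrite lead_coefE size_exp_XsubC /= => ->.
Qed.

(** The relevant coefficient is that of X^f in (X - 1)^(3f), whose sign is (-1)^(2f) = 1. *)
Lemma sum_shift_bin :
  \sum_(x : F) x ^+ (3 * f) * (x - 1) ^+ (3 * f) = - ('C(3 * f, f))%:R.
Proof.
have f_gt0 := f0; rewrite coef_sum_expr; last by lia.
rewrite coefXnM ltn_mul2r /= andbF -mulnBl mul1n.
have ltf : (f < (3 * f).+1)%N by lia.
have -> : 'X - 1%:P = (-1)%:P + 'X :> {poly F} by rewrite addrC polyCN.
rewrite exprDn coef_sum (bigD1 (Ordinal ltf)) //= big1 ?addr0 => [|i].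
  rewrite coefMn -polyC_exp coefCM coefXn eqxx mulr1.
  have -> : (3 * f - f = f + f)%N by lia.
  by rewrite exprD -expr2 sqrr_sign.
rewrite -val_eqE /= => ni.
by rewrite coefMn -polyC_exp coefCM coefXn eq_sym (negPf ni) mulr0 mul0rn.
Qed.

Lemma nonzero_exp (x : F) : x != 0 -> exists m : nat, x = w ^+ m.
Proof.
move=> x0; have /(prim_rootP w_prim)[m ->] : x ^+ #|F|.-1 = 1.
  by rewrite cardF expf_order.
by exists m.
Qed.

Lemma two_neq0 : 2 != 0 :> F.
Proof.
apply/eqP => two0; have := natr4f; rewrite natrM -[4%N]/(2 * 2)%N natrM two0.
by rewrite !mul0r => /esym/eqP; rewrite oppr_eq0 oner_eq0.
Qed.

Lemma expwf_eq1 (m : nat) : (w ^+ f ^+ m == 1) = (4 %| m)%N.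
Proof.
by rewrite -exprM -(prim_order_dvd w_prim) cardF mulnC dvdn_pmul2l ?f0.
Qed.

Lemma expwf2 : (w ^+ f) ^+ 2 = -1.
Proof.
have /eqP : (w ^+ f ^+ 2) ^+ 2 = 1.
  by rewrite -exprM; apply/eqP; rewrite expwf_eq1.
by rewrite sqrf_eq1 expwf_eq1 /= => /eqP.
Qed.

Lemma mem_cyc_class (m i : nat) : (i < 4)%N ->
  (w ^+ m \in cyc_class w i) = (m %% 4 == i)%N.
Proof.
move=> i4; apply/imsetP/eqP => [[_ /imsetP[j _ ->]] | mi].
  move/eqP; rewrite -exprD (eq_prim_root_expr w_prim) => /eqP e.
  have d4 : (4 %| #|F|.-1)%N by rewrite cardF dvdn_mulr.
  have := congr1 (modn^~ 4) e; rewrite /= !modn_dvdm // => ->.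
  by rewrite addnC mulnC modnMDl modn_small.
(* Reducing the index modulo f meets the ordinal bound and changes the exponent of [w] by a multiple
   of 4f only. *)
have jf : ((m %/ 4) %% f < #|F|.-1 %/ 4)%N.
  by rewrite cardF mulKn // ltn_mod f0.
exists (w ^+ (4 * ((m %/ 4) %% f))); first by apply/imsetP; exists (Ordinal jf).
apply/eqP; rewrite -exprD (eq_prim_root_expr w_prim) cardF.
rewrite [in X in X == _](divn_eq m 4) mi addnC [(_ * 4)%N]mulnC eqn_modDl.
by rewrite -!muln_modr modn_mod.
Qed.

Lemma cyc_class0F (i : nat) : (0 \in cyc_class w i) = false.
Proof.
apply/negP => /imsetP[_ /imsetP[j _ ->]] /esym/eqP.
by rewrite -exprD expf_eq0 (negPf w0) andbF.
Qed.

Lemma eq_from_exp (T : Type) (a b : F -> T) :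
  a 0 = b 0 -> (forall m : nat, a (w ^+ m) = b (w ^+ m)) -> a =1 b.
Proof.
by move=> ab0 abw x; have [-> // | /nonzero_exp[m ->]] := eqVneq x 0.
Qed.

End FiniteField.

(** * Autocorrelation, the coefficients of D D^-1 *)

Definition autocorr (F : finFieldType) (d : F -> int) (g : F) : int :=
  \sum_(h : F) d h * d (h - g).

(** Reindexing by [phi] moves it from the shift into the function. It serves for multiplication by a
    nonzero scalar and for Frobenius. *)
Lemma autocorr_inj (F : finFieldType) (d : F -> int) (phi : F -> F) (g : F) :
  injective phi -> {morph phi : x y / x - y} ->
  autocorr d (phi g) = autocorr (d \o phi) g.
Proof.
move=> phi_inj phiB; rewrite /autocorr (reindex_inj phi_inj) /=.
by apply: eq_bigr => h _; rewrite phiB.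
Qed.

Lemma autocorrM (F : finFieldType) (d : F -> int) (a g : F) : a != 0 ->
  autocorr d (a * g) = autocorr (fun x => d (a * x)) g.
Proof.
by move=> a0; apply: autocorr_inj => [|x y]; [apply: mulfI | rewrite mulrBr].
Qed.

Lemma eq_autocorr (F : finFieldType) (d e : F -> int) : d =1 e ->
  autocorr d =1 autocorr e.
Proof. by move=> de g; apply: eq_bigr => h _; rewrite !de. Qed.

Lemma autocorrN (F : finFieldType) (d : F -> int) (g : F) :
  autocorr (fun x => - d x) g = autocorr d g.
Proof. by apply: eq_bigr => h _; rewrite mulrNN. Qed.

(** The augmentation Z[G] -> Z is multiplicative and takes the same value on D and D^-1. *)
Lemma sum_autocorr (F : finFieldType) (d : F -> int) :
  \sum_g autocorr d g = (\sum_h d h) ^+ 2.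
Proof.
rewrite exchange_big expr2 big_distrl /=; apply: eq_bigr => h _.
rewrite -big_distrr /=; congr (_ * _).
rewrite (reindex_inj (inv_inj (subKr h))) /=.
by apply: eq_bigr => g _; rewrite subKr.
Qed.

Lemma gr_mul_inv (F : finFieldType) (A : {ffun F -> int}) (g : F) :
  gr_mul A (gr_inv A) g = autocorr A g.
Proof. by rewrite ffunE; apply: eq_bigr => h _; rewrite ffunE opprB. Qed.

Lemma sds_rhsE (F : finFieldType) (k lambda : int) (g : F) :
  (gr_set [set: F] *~ lambda + gr_set [set 0] *~ (k - lambda)) g
  = if g == 0 then k else lambda.
Proof.
have mulzE (A : {ffun F -> int}) z : (A *~ z) g = A g *~ z.
  case: z => m; first by rewrite -!pmulrn ffunMnE.
  by rewrite NegzE !mulrNz -!pmulrn ffunE ffunMnE.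
rewrite ffunE !mulzE !ffunE !inE.
case: eqP => _; last by rewrite mul0rz addr0 intz.
by rewrite !intz addrC subrK.
Qed.

(** * Part (1): all nonzero elements, one class taken with sign -1 *)

Section ComplementOfClass.
Context {F : finFieldType} {w : F} {f l : nat} {d : F -> int} {lambda : int}.
Hypothesis w_prim : (#|F|.-1).-primitive_root w.
Hypothesis cardF : #|F|.-1 = (4 * f)%N.
Hypothesis l4 : (l < 4)%N.
Hypothesis d0 : d 0 = 0.
Hypothesis dw : forall m : nat, d (w ^+ m) = if (m %% 4 == l)%N then -1 else 1.
Hypothesis d_autocorr : forall g, g != 0 -> autocorr d g = lambda.

Let f0 := f_gt0 w_prim cardF.
Let w0 := prim_neq0 w_prim cardF.

(** Modulo 2, [d] agrees with the indicator [u] of the nonzero elements, so the autocorrelation of d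
    - u is divisible by 4; expanding it yields [cong]. For odd f, d(g) + d(-g) is 0 on C_l but 2 on
    C_(l+1). *)
Lemma compl_class_even : ~~ odd f.
Proof.
apply/negP => f_odd.
pose u (x : F) : int := (x != 0)%:R.
have d_even x : (2 %| d x - u x)%Z.
  have [-> | x0] := eqVneq x 0; first by rewrite d0 /u eqxx.
  rewrite /u x0; have [m ->] := nonzero_exp w_prim cardF x0.
  by rewrite dw; case: ifP.
have cong g : (4 %| autocorr d g + d g + d (- g) + autocorr u g
                    - (\sum_h d h) *+ 2)%Z.
  have -> : autocorr d g + d g + d (- g) + autocorr u g - (\sum_h d h) *+ 2
          = \sum_h (d h - u h) * (d (h - g) - u (h - g)).
    have sumdu : \sum_h d h * u (h - g) = \sum_h d h - d g.
      rewrite (bigD1 g) //= [in RHS](bigD1 g) //= /u.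
      rewrite subrr eqxx mulr0 add0r addrAC subrr add0r.
      by apply: eq_bigr => h hg; rewrite subr_eq0 hg mulr1.
    have sumud : \sum_h u h * d (h - g) = \sum_h d h - d (- g).
      have -> : \sum_h d h = \sum_h d (h - g).
        by rewrite (reindex_inj (subIr g)).
      rewrite (bigD1 0) //= [in RHS](bigD1 0) //= /u eqxx mul0r add0r.
      rewrite sub0r addrAC subrr add0r.
      by apply: eq_bigr => h hg; rewrite hg mul1r.
    transitivity (\sum_h d h * d (h - g) - \sum_h d h * u (h - g)
                  - \sum_h u h * d (h - g) + \sum_h u h * u (h - g)).
      by rewrite sumdu sumud /autocorr; ring.
    rewrite -!sumrB -big_split /=.
    by apply: eq_bigr => h _; ring.
  apply: (big_ind (fun z => (4 %| z)%Z)) => [|x y|h _] //; first exact: rpredD.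
  by rewrite -[4]/(2 * 2 : int) dvdz_mul.
have wN : w ^+ (2 * f) = -1 by rewrite mulnC exprM (expwf2 w_prim cardF).
have c1 := cong (w ^+ l); have c2 := cong (w ^+ l.+1).
(* [u] is invariant under multiplication by [w], so its contribution cancels and 4 would divide
   2. *)
have uE : autocorr u (w ^+ l.+1) = autocorr u (w ^+ l).
  rewrite exprS autocorrM //; apply: eq_autocorr => x.
  by rewrite /u mulf_eq0 (negPf w0).
have e1 : d (- w ^+ l) = 1.
  by rewrite -mulN1r -wN -exprD dw ifN //; lia.
have e2 : d (- w ^+ l.+1) = 1.
  by rewrite -mulN1r -wN -exprD dw ifN //; lia.
have e3 : d (w ^+ l) = -1 by rewrite dw ifT //; lia.
have e4 : d (w ^+ l.+1) = 1 by rewrite dw ifN //; lia.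
move: c1 c2; rewrite uE !d_autocorr ?expf_neq0 // e1 e2 e3 e4.
lia.
Qed.

(** The sum of g^f * 4 N(g) is computed twice: constancy of N off 0 gives 0 ([zero]), the polynomial
    form of [d] gives -2 c^3 ([total]). *)
Lemma compl_class_not_const : False.
Proof.
have ev := compl_class_even.
(* With y = c x^f, a fourth root of unity equal to 1 exactly on C_l, the value
   of 2 d(x) at x <> 0 is 1 - y - y^2 - y^3. *)
pose c : F := w ^+ f ^+ (4 - l).
(* The first term is x^(4f) instead of 1, so that e also vanishes at 0, as [d] does. *)
pose e (x : F) :=
  x ^+ (4 * f) - c * x ^+ f - c ^+ 2 * x ^+ (2 * f) - c ^+ 3 * x ^+ (3 * f).
have dE : forall x, 2 * (d x)%:~R = e x :> F.
  apply: (eq_from_exp w_prim cardF) => [|m].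
    by rewrite d0 /e !expr0n !muln_eq0 (gtn_eqF f0) /=; ring.
  pose y := c * (w ^+ m) ^+ f.
  have yE : y = w ^+ f ^+ (4 - l + m).
    by rewrite exprD -[X in _ * X]exprM mulnC exprM.
  have y4 : y ^+ 4 = 1.
    by rewrite yE -exprM; apply/eqP; rewrite (expwf_eq1 w_prim cardF) dvdn_mull.
  have -> : e (w ^+ m) = 1 - y - y ^+ 2 - y ^+ 3.
    rewrite /e (expf_order cardF) ?expf_neq0 // /y !exprMn.
    by rewrite ![(_ * f)%N]mulnC !exprM.
  have y1 : (y == 1) = (m %% 4 == l)%N.
    by rewrite yE (expwf_eq1 w_prim cardF); move: l4; lia.
  rewrite dw -y1; have [-> | yn1] := eqVneq y 1.
    by rewrite mulrNz; ring.
  have geo : 1 + y + y ^+ 2 + y ^+ 3 = 0.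
    apply: (mulfI (_ : y - 1 != 0)); first by rewrite subr_eq0.
    transitivity (y ^+ 4 - 1); first by ring.
    by rewrite y4 subrr mulr0.
  transitivity (2 - (1 + y + y ^+ 2 + y ^+ 3)); last by ring.
  by rewrite geo subr0 mulr1.
have sum_e : \sum_x e x = -1.
  rewrite /e !sumrB -!big_distrr !(sum_expr w_prim cardF) /=; try lia.
  have -> : (f == 4 * f)%N = false by lia.
  have -> : (2 * f == 4 * f)%N = false by lia.
  have -> : (3 * f == 4 * f)%N = false by lia.
  by rewrite eqxx /=; ring.
(* Only the terms of degree at least 4f contribute: x^(3f) (x - h)^f, and x^(4f) (x - h)^f with
   coefficient (-h)^f = h^f as f is even. *)
have sum_e_shift h : \sum_x e x * (x - h) ^+ f = - h ^+ f + c ^+ 3.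
  transitivity (\sum_x x ^+ (4 * f) * (x - h) ^+ f
    - c * (\sum_x x ^+ f * (x - h) ^+ f)
    - c ^+ 2 * (\sum_x x ^+ (2 * f) * (x - h) ^+ f)
    - c ^+ 3 * (\sum_x x ^+ (3 * f) * (x - h) ^+ f)).
    rewrite !big_distrr -!sumrB; apply: eq_bigr => x _ /=.
    by rewrite /e; ring.
  rewrite (sum_shift_eq w_prim cardF (a := 3 * f)); last by lia.
  rewrite (sum_shift_small w_prim cardF (a := f)); last by lia.
  rewrite (sum_shift_small w_prim cardF (a := 2 * f)); last by lia.
  have -> : \sum_x x ^+ (4 * f) * (x - h) ^+ f = - h ^+ f.
    rewrite (coef_sum_expr w_prim cardF); last by lia.
    rewrite coefXnM ltnn subnn -horner_coef0 !hornerE /= exprNn.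
    by rewrite -signr_odd (negPf ev) mul1r.
  by ring.
have sum_ee : \sum_x e x * x ^+ f = c ^+ 3.
  under eq_bigr => x _ do rewrite -[in X in _ * X](subr0 x).
  by rewrite sum_e_shift expr0n (gtn_eqF f0) oppr0 add0r.
have total : \sum_g g ^+ f * (4 * (autocorr d g)%:~R) = - 2 * c ^+ 3 :> F.
  transitivity (\sum_h e h * \sum_g e (h - g) * g ^+ f).
    under [RHS]eq_bigr do rewrite big_distrr /=.
    rewrite [RHS]exchange_big /=; apply: eq_bigr => g _.
    rewrite /autocorr rmorph_sum !big_distrr /=; apply: eq_bigr => h _.
    by rewrite -!dE rmorphM /=; ring.
  (* After g -> h - g, evenness of f turns (h - x)^f into (x - h)^f. *)
  have inner h : \sum_g e (h - g) * g ^+ f = - h ^+ f + c ^+ 3.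
    rewrite -sum_e_shift (reindex_inj (inv_inj (subKr h))) /=.
    apply: eq_bigr => g _; rewrite subKr -opprB exprNn.
    by rewrite -signr_odd (negPf ev) mul1r.
  under eq_bigr do rewrite inner mulrDr mulrN.
  by rewrite big_split /= sumrN -big_distrl /= sum_e sum_ee; ring.
(* The factor 0^f = 0 removes the exceptional value N(0). *)
have zero : \sum_g g ^+ f * (4 * (autocorr d g)%:~R) = 0 :> F.
  transitivity (4 * lambda%:~R * \sum_g g ^+ f : F).
    rewrite big_distrr /=; apply: eq_bigr => g _.
    have [-> | g0] := eqVneq g 0; last by rewrite d_autocorr //; ring.
    by rewrite expr0n (gtn_eqF f0) mul0r mulr0.
  rewrite (sum_expr w_prim cardF); last by lia.
  have -> : (f == 4 * f)%N = false by lia.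
  by rewrite oppr0 mulr0.
move: total; rewrite zero => /esym/eqP; rewrite mulf_eq0 oppr_eq0.
rewrite (negPf (two_neq0 cardF)) expf_eq0 /= /c -exprM expf_eq0.
by rewrite (negPf w0) andbF.
Qed.

End ComplementOfClass.

(** * Signs on the nonzero elements that some multiplication reverses *)

Section BalancedSign.
Context {F : finFieldType} {w : F} {f : nat} {d : F -> int}.
Hypothesis w_prim : (#|F|.-1).-primitive_root w.
Hypothesis cardF : #|F|.-1 = (4 * f)%N.
Hypothesis d0 : d 0 = 0.
Hypothesis d_sqr : forall x, x != 0 -> d x ^+ 2 = 1.

Let f0 := f_gt0 w_prim cardF.
Let w0 := prim_neq0 w_prim cardF.

Lemma autocorr0 : autocorr d 0 = #|F|.-1%:Z.
Proof.
rewrite /autocorr (bigD1 0) //= d0 mul0r add0r.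
under eq_bigr => h h0 do rewrite subr0 -expr2 d_sqr //.
by rewrite sumr_const cardC1 natz.
Qed.

(** The sign reversal forces sum d = 0, hence 0 = N(0) + 4f N(1) with N(0) = 4f. *)
Lemma autocorr_const (a : F) : a != 0 -> (forall x, d (a * x) = - d x) ->
  (forall m : nat, autocorr d (w ^+ m) = autocorr d 1) ->
  forall g, g != 0 -> autocorr d g = -1.
Proof.
move=> a0 da const.
have sum0 : \sum_h d h = 0.
  have : \sum_h d h = - \sum_h d h.
    rewrite [LHS](reindex_inj (mulfI a0)) /= -sumrN.
    by apply: eq_bigr => h _; rewrite da.
  lia.
have const' g : g != 0 -> autocorr d g = autocorr d 1.
  by move=> g0; have [m ->] := nonzero_exp w_prim cardF g0.
have := sum_autocorr d; rewrite sum0 expr0n /= (bigD1 0) //= autocorr0.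
under eq_bigr => g g0 do rewrite const' //.
rewrite sumr_const cardC1 -mulr_natl natz cardF => E g g0.
rewrite const' //; move: f0 E; nia.
Qed.

Lemma autocorr_alternating : (forall x, d (w * x) = - d x) ->
  forall g, g != 0 -> autocorr d g = -1.
Proof.
move=> dw; apply: (autocorr_const w0 dw); elim=> // m <-.
by rewrite exprS autocorrM // (eq_autocorr dw) autocorrN.
Qed.

(** Negation under w^2 leaves only N(1) and N(w) to compare. Frobenius fixes 1 and acts on [d] as
    multiplication by w^k, so N(1) = N(w^k) = N(w), k being odd. *)
Lemma autocorr_frobenius (p k : nat) : p \in [pchar F] -> odd k ->
  (forall x, d (w ^+ 2 * x) = - d x) ->
  (forall x, d (x ^+ p) = d (w ^+ k * x)) ->
  forall g, g != 0 -> autocorr d g = -1.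
Proof.
move=> pF k_odd dw2 dp; apply: (autocorr_const (expf_neq0 2 w0) dw2).
have step m : autocorr d (w ^+ m.+2) = autocorr d (w ^+ m).
  by rewrite -addn2 addnC exprD autocorrM ?expf_neq0 //
             (eq_autocorr dw2) autocorrN.
have reduce m : autocorr d (w ^+ m) = autocorr d (w ^+ odd m).
  elim/ltn_ind: m => -[|[|m]] // IH.
  by rewrite step IH //= negbK.
suff one : autocorr d w = autocorr d 1.
  by move=> m; rewrite reduce; case: (odd m); rewrite ?expr1 ?expr0.
have /(_ d 1) : forall e g,
    autocorr e (pFrobenius_aut pF g) = autocorr (e \o pFrobenius_aut pF) g.
  by move=> e g; apply: autocorr_inj; [apply: fmorph_inj | apply: rmorphB].
rewrite rmorph1 => ->.
rewrite (_ : autocorr (d \o _) 1 = autocorr (fun x => d (w ^+ k * x)) 1).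
  by rewrite -autocorrM ?expf_neq0 // mulr1 reduce k_odd.
by apply: eq_autocorr => x; rewrite -dp.
Qed.

End BalancedSign.

(** * Part (2), i - j odd: sign 1 on two cyclically consecutive classes *)

Section HalfOfClasses.
Context {F : finFieldType} {w : F} {f i : nat} {d : F -> int}.
Hypothesis w_prim : (#|F|.-1).-primitive_root w.
Hypothesis cardF : #|F|.-1 = (4 * f)%N.
Hypothesis d0 : d 0 = 0.
Hypothesis dw : forall m : nat,
  d (w ^+ m) = if ((m + i) %% 4 < 2)%N then 1 else -1.

Let f0 := f_gt0 w_prim cardF.
Let w0 := prim_neq0 w_prim cardF.

(** Expanding 4 N(1) in A x^f + B x^(3f), the A^2 term vanishes and the two cross terms give -2
    each, as A B = 2. They account for all of 4 * (-1), so the B^2 term, a nonzero multiple of the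
    binomial, must be 0. *)
Lemma half_autocorr1 : autocorr d 1 = -1 -> ('C(3 * f, f))%:R = 0 :> F.
Proof.
move=> N1; pose I : F := w ^+ f.
have I2 : I ^+ 2 = -1 := expwf2 w_prim cardF.
have IE m : I ^+ m = I ^+ (m %% 4).
  rewrite [in LHS](divn_eq m 4) exprD mulnC exprM -[4%N]/(2 * 2)%N exprM I2.
  by rewrite sqrrN expr1n expr1n mul1r.
pose c := I ^+ i.
(* (1 - I) y + (1 + I) y^3 is 2 at y = 1, I and -2 at y = -1, -I. *)
pose A := (1 - I) * c; pose B := (1 + I) * c ^+ 3.
have dE : forall x, 2 * (d x)%:~R = A * x ^+ f + B * x ^+ (3 * f) :> F.
  apply: (eq_from_exp w_prim cardF) => [|m].
    by rewrite d0 !expr0n !muln_eq0 (gtn_eqF f0) /=; ring.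
  pose y := c * (w ^+ m) ^+ f.
  have yE : y = I ^+ ((m + i) %% 4).
    rewrite -IE [RHS]exprD [RHS]mulrC /y /I.
    by rewrite -[(w ^+ m) ^+ f]exprM mulnC exprM.
  transitivity ((1 - I) * y + (1 + I) * y ^+ 3); last first.
    by rewrite /A /B /y mulnC exprM; ring.
  rewrite dw yE; have := ltn_mod (m + i) 4.
  case: ((m + i) %% 4)%N => [|[|[|[|r]]]] //= _.
  - by ring.
  - by ring: I2.
  - by ring: I2.
  - by ring: I2.
have : 4 * (autocorr d 1)%:~R = A ^+ 2 * (\sum_x x ^+ f * (x - 1) ^+ f)
   + A * B * (\sum_x x ^+ f * (x - 1) ^+ (3 * f))
   + A * B * (\sum_x x ^+ (3 * f) * (x - 1) ^+ f)
   + B ^+ 2 * (\sum_x x ^+ (3 * f) * (x - 1) ^+ (3 * f)) :> F.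
  rewrite /autocorr rmorph_sum !big_distrr -!big_split /=.
  apply: eq_bigr => x _; rewrite rmorphM /=.
  transitivity ((2 * (d x)%:~R) * (2 * (d (x - 1))%:~R) : F); first by ring.
  by rewrite !dE; ring.
rewrite N1 (sum_shift_bin w_prim cardF).
rewrite (sum_shift_small w_prim cardF (a := f) (b := f)); last by move: f0; lia.
rewrite (sum_shift_eq w_prim cardF (a := f)); last by lia.
rewrite (sum_shift_eq w_prim cardF (a := 3 * f)); last by lia.
have c4 : c ^+ 4 = 1 by rewrite /c -exprM IE modnMl expr0.
have AB : A * B = 2.
  transitivity ((1 - I ^+ 2) * c ^+ 4); first by rewrite /A /B; ring.
  by rewrite I2 c4; ring.
have BB : B ^+ 2 = 2 * I * c ^+ 2.
  transitivity ((1 + 2 * I + I ^+ 2) * c ^+ 4 * c ^+ 2).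
    by rewrite /B; ring.
  by rewrite I2 c4; ring.
rewrite AB BB => E; have : 2 * I * c ^+ 2 * 'C(3 * f, f)%:R = 0.
  transitivity (4 * (-1)%:~R - (A ^+ 2 * 0 + 2 * -1 + 2 * -1
      + 2 * I * c ^+ 2 * - 'C(3 * f, f)%:R) : F); last by rewrite E subrr.
  by rewrite mulrNz; ring.
move/eqP; rewrite !mulf_eq0 (negPf (two_neq0 cardF)) /c /I !expf_eq0 (negPf w0).
by rewrite !andbF /= => /eqP.
Qed.
Lemma half_sqr (x : F) : x != 0 -> d x ^+ 2 = 1.
Proof.
by move=> x0; have [m ->] := nonzero_exp w_prim cardF x0; rewrite dw; case: ifP.
Qed.

Lemma half_not_sds (p n : nat) :
  prime p -> (p %% 4 = 1)%N -> #|F| = (p ^ n)%N ->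
  autocorr d 1 <> -1.
Proof.
move=> p_prime p4 cardFp /half_autocorr1 /eqP.
rewrite -(dvdn_pcharf (card_finPcharP cardFp p_prime)).
apply/negP/(@ndvdn_bin_3f_f p n) => //.
by rewrite -cardFp (cardFS cardF) addn1.
Qed.

Lemma half_sds (p n : nat) :
  prime p -> (p %% 4 = 3)%N -> #|F| = (p ^ n)%N ->
  forall g, g != 0 -> autocorr d g = -1.
Proof.
move=> p_prime p4 cardFp.
(* With s = m + (2i + 1) + i, one has 3m + i = 1 - s modulo 4, and s -> 1 - s preserves {0, 1};
   hence the shift 2i + 1 for Frobenius. *)
have k_odd : odd (2 * i).+1 by lia.
apply: (autocorr_frobenius w_prim cardF d0 half_sqr
         (card_finPcharP cardFp p_prime) k_odd).
- apply: (eq_from_exp w_prim cardF) => [|m]; first by rewrite mulr0 d0.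
  rewrite -exprD !dw.
  have -> : ((2 + m + i) %% 4 < 2)%N = ~~ ((m + i) %% 4 < 2)%N by lia.
  by rewrite if_neg; case: ifP.
- apply: (eq_from_exp w_prim cardF) => [|m].
    by rewrite mulr0 expr0n (gtn_eqF (prime_gt0 p_prime)).
  rewrite -exprM -exprD !dw.
  have -> : (m * p = 4 * (m * (p %/ 4)) + 3 * m)%N.
    by rewrite {1}(divn_eq p 4) p4; lia.
  by congr (if _ then _ else _); lia.
Qed.

End HalfOfClasses.

(** * From signed sets to sign functions *)

Section SignedSets.
Context {F : finFieldType} {w : F} {f : nat}.
Hypothesis w_prim : (#|F|.-1).-primitive_root w.
Hypothesis cardF : #|F|.-1 = (4 * f)%N.

Lemma sds_autocorr (v k : nat) (lambda : int) (D : signed_set F) (g : F) :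
  is_sds v k lambda D -> g != 0 -> autocorr (signed_elt D) g = lambda.
Proof.
by case=> _ _ DD g0; rewrite -gr_mul_inv DD sds_rhsE (negPf g0).
Qed.

Lemma signed_eltE (D : signed_set F) (x : F) :
  signed_elt D x = (x \in pos_part D)%:R - (x \in neg_part D)%:R.
Proof. by rewrite !ffunE. Qed.

Lemma compl_class_not_sds (l : 'I_4) (D : signed_set F) :
  pos_part D = [set: F] :\: (cyc_class w l :|: [set 0]) ->
  neg_part D = cyc_class w l -> ~ signed_difference_set D.
Proof.
move=> posD negD [lambda sdsD].
apply: (compl_class_not_const w_prim cardF (ltn_ord l) _ _
          (fun g => @sds_autocorr _ _ lambda D g sdsD)) => [|m].
  by rewrite signed_eltE posD negD !inE eqxx orbT (cyc_class0F w_prim cardF).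
rewrite signed_eltE posD negD !inE (mem_cyc_class w_prim cardF) //.
by rewrite expf_eq0 (negPf (prim_neq0 w_prim cardF)) andbF; case: eqP.
Qed.

Context {i j k l : 'I_4} {D : signed_set F}.
Hypothesis ijkl : [set i; j; k; l] = [set: 'I_4].
Hypothesis posD : pos_part D = cyc_class w i :|: cyc_class w j.
Hypothesis negD : neg_part D = cyc_class w k :|: cyc_class w l.

Let d := signed_elt D.

Lemma union_uniq : uniq [:: i; j; k; l].
Proof.
apply: (leq_size_uniq (enum_uniq 'I_4)) => [x _|]; last first.
  by rewrite size_enum_ord.
by have := in_setT x; rewrite -ijkl !inE -!orbA.
Qed.

Lemma union_elt0 : d 0 = 0.
Proof.
by rewrite signed_eltE posD negD !inE !(cyc_class0F w_prim cardF).
Qed.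

Lemma union_elt_exp (m : nat) :
  d (w ^+ m) = if (m %% 4 == i)%N || (m %% 4 == j)%N then 1 else -1.
Proof.
rewrite signed_eltE posD negD !inE !(mem_cyc_class w_prim cardF) //.
have m4 : (m %% 4 < 4)%N by rewrite ltn_mod.
have := in_setT (Ordinal m4); rewrite -ijkl !inE -!val_eqE /=.
have := union_uniq; rewrite /= !inE -!val_eqE /= => uniq4 mem4.
have [mi | mi] := eqVneq (m %% 4)%N i; have [mj | mj] := eqVneq (m %% 4)%N j;
have [mk | mk] := eqVneq (m %% 4)%N k;
have [ml | ml] := eqVneq (m %% 4)%N l => //=; lia.
Qed.

Lemma union_sqr (x : F) : x != 0 -> d x ^+ 2 = 1.
Proof.
move=> x0; have [m ->] := nonzero_exp w_prim cardF x0.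
by rewrite union_elt_exp; case: ifP.
Qed.

(** The coefficient at 0 is q - 1 in any case, so only the shifts g <> 0 carry a condition. *)
Lemma union_sdsP :
  is_sds #|F| #|F|.-1 (-1) D <-> (forall g, g != 0 -> autocorr d g = -1).
Proof.
split=> [sdsD g | N]; first exact: sds_autocorr sdsD.
split=> //.
  (* As d^2 = 1 off 0, each nonzero element lies in one of the two parts. *)
  have <- : #|pos_part D :|: neg_part D| = #|F|.-1.
    rewrite -(cardC1 (0 : F)); apply: eq_card => x; rewrite [RHS]inE.
    have [-> | x0] := eqVneq x 0.
      by rewrite posD negD !inE !(cyc_class0F w_prim cardF).
    have := union_sqr x0; rewrite signed_eltE inE.
    by case: (x \in pos_part D); case: (x \in neg_part D).
  by rewrite cardsU (disjoint_setI0 (parts_disjoint D)) cards0 subn0.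
apply/ffunP => g; rewrite gr_mul_inv sds_rhsE.
have [-> | g0] := eqVneq g 0; last exact: N.
exact: autocorr0 union_elt0 union_sqr.
Qed.

End SignedSets.

Theorem proposition5p4 (p n : nat) (F : finFieldType) (w : F)
    (p_prime : prime p) (p_odd : odd p)
    (cardF : #|F| = (p ^ n)%N)
    (q_mod4 : (p ^ n = 1 %[mod 4])%N)
    (w_prim : (#|F|.-1).-primitive_root w) :
  (forall (l : 'I_4) (D : signed_set F),
     pos_part D = [set: F] :\: (cyc_class w l :|: [set 0]) ->
     neg_part D = cyc_class w l ->
     ~ signed_difference_set D)
  /\
  (forall (i j k l : 'I_4) (D : signed_set F),
     [set i; j; k; l] = [set: 'I_4] ->
     pos_part D = cyc_class w i :|: cyc_class w j ->
     neg_part D = cyc_class w k :|: cyc_class w l ->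
     (is_sds (p ^ n) (p ^ n).-1 (-1) D <->
      ((i%:Z - j%:Z = 2 %[mod 4])%Z \/
       (((i%:Z - j%:Z = 1 %[mod 4])%Z \/ (i%:Z - j%:Z = 3 %[mod 4])%Z) /\
        (p%:Z = -1 %[mod 4])%Z)))).
Proof.
have cardF4 : #|F|.-1 = (4 * (#|F|.-1 %/ 4))%N.
  by have := prim_order_gt0 w_prim; rewrite cardF; lia.
split=> [l D | i j k l D ijkl posD negD].
  exact: compl_class_not_sds w_prim cardF4 l D.
have uniq4 : i != j :> nat.
  by have := union_uniq ijkl; rewrite /= !inE => /andP[/norP[]].
have dw := union_elt_exp w_prim cardF4 ijkl posD negD.
have d0 := union_elt0 w_prim cardF4 posD negD.
have ds := union_sqr w_prim cardF4 ijkl posD negD.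
have sdsP := union_sdsP w_prim cardF4 ijkl posD negD.
have i4 := ltn_ord i; have j4 := ltn_ord j; rewrite -cardF.
have p4 : (p %% 4 = 1)%N \/ (p %% 4 = 3)%N by lia.
have [ij2 | ij2] := eqVneq ((i + 2) %% 4)%N j.
  split=> _; first by left; lia.
  apply/sdsP/(autocorr_alternating w_prim cardF4 d0 ds).
  apply: (eq_from_exp w_prim cardF4) => [|m]; first by rewrite mulr0 d0.
  rewrite -exprS !dw.
  have -> : (m.+1 %% 4 == i)%N || (m.+1 %% 4 == j)%N
          = ~~ ((m %% 4 == i)%N || (m %% 4 == j)%N) by lia.
  by rewrite if_neg; case: ifP.
(* Here j = i + 1 or i = j + 1 modulo 4; the shift sends the first of the two consecutive classes to
   residue 0. *)
have [a dwa] : exists a : nat, forall m : nat,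
    signed_elt D (w ^+ m) = if ((m + a) %% 4 < 2)%N then 1 else -1.
  have [ij1 | ij1] := eqVneq ((i + 1) %% 4)%N j.
    by exists (4 - i)%N => m; rewrite dw; congr (if _ then _ else _); lia.
  by exists (4 - j)%N => m; rewrite dw; congr (if _ then _ else _); lia.
split=> [/sdsP N | ij].
  right; split; first by lia.
  case: p4 => [p1 | p3]; last by lia.
  have := half_not_sds w_prim cardF4 d0 dwa p_prime p1 cardF.
  by rewrite N ?oner_neq0.
have p3 : (p %% 4 = 3)%N by lia.
exact/sdsP/(half_sds w_prim cardF4 d0 dwa p_prime p3 cardF).
Qed.
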